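(* Let $t\mapsto q(t)$ parametrize the spheres of an M-sphere pencil $\mathcal{M}$ and denote by $t\mapsto\sigma_t$ the evolution map associated to $\mathcal{M}$ based at $t_0$. Let $u\mapsto\gamma(u)\in\mathbb{P}(\gamma\cap\mathcal{L})$ be a parametrization of the points of a circle $\Gamma=(\gamma,\gamma^\perp)$ that lies on the initial sphere $q_0:=q(t_0)$. Then $$(u,t)\mapsto\sigma_t(\gamma(u))$$ provides either a 2-dimensional orthogonal coordinate system of circles on a sphere or a curvature line parametrization of a Dupin cyclide.
   Context: Lie sphere geometry: $\mathbb{R}^{4,2}$ is $\mathbb{R}^6$ with a symmetric bilinear form $\langle\cdot,\cdot\rangle$ of signature $(4,2)$. Points $s=\mathrm{span}\{\mathfrak{s}\}$ of the Lie quadric $\mathbb{P}(\mathcal{L})=\{\mathrm{span}\{\mathfrak{s}\}\,|\,\langle\mathfrak{s},\mathfrak{s}\rangle=0,\ \mathfrak{s}\ne0\}$ are oriented 2-spheres (including points and planes); two spheres are in oriented contact iff $\langle\mathfrak{s}_1,\mathfrak{s}_2\rangle=0$. A contact element is a projective line contained in $\mathbb{P}(\mathcal{L})$. Möbius subgeometry: a point sphere complex $\mathfrak{p}$, $\langle\mathfrak{p},\mathfrak{p}\rangle=-1$, is fixed; point spheres (points) are the $v\in\mathbb{P}(\mathcal{L})$ with $\langle\mathfrak{v},\mathfrak{p}\rangle=0$. Spheres $s_1,s_2$ are orthogonal iff $\langle\mathfrak{s}_1,\mathfrak{s}_2+\langle\mathfrak{s}_2,\mathfrak{p}\rangle\mathfrak{p}\rangle=0$;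 a point sphere is orthogonal to a sphere iff it lies on it. A circle is a pair $\Gamma=(\gamma,\gamma^\perp)$ with $\gamma\subset\mathrm{span}\{\mathfrak{p}\}^\perp$ of dimension 3 and signature $(2,1)$; its points are the elements of $\mathbb{P}(\gamma\cap\mathcal{L})$; it lies on the sphere $s$ iff $\mathfrak{s}\in\gamma^\perp$. Lie inversion: for $\langle\mathfrak{a},\mathfrak{a}\rangle\ne0$, $\sigma_a(\mathfrak{r})=\mathfrak{r}-\frac{2\langle\mathfrak{r},\mathfrak{a}\rangle}{\langle\mathfrak{a},\mathfrak{a}\rangle}\mathfrak{a}$. It is an M-Lie inversion if it preserves the point sphere complex $\mathfrak{p}$. M-sphere pencil: for spheres $s_1,s_2$ with $\mathfrak{s}_1\notin\mathrm{span}\{\mathfrak{s}_2,\mathfrak{p}\}$, the set of spheres in $\mathcal{M}=\mathrm{span}\{\mathfrak{s}_1,\mathfrak{s}_2,\mathfrak{p}\}$. If $J\ni t\mapsto q(t)$ parametrizes the oriented spheres in $\mathcal{M}$ and $q_0=q(t_0)$ is not a point sphere, the evolution map associated to $\mathcal{M}$ based at $t_0$ is the family of M-Lie inversions $\sigma_t:=\sigma_{a_t}$ with $\mathfrak{a}_t=\langle\mathfrak{q}(t),\mathfrak{p}\rangle\mathfrak{q}_0-\langle\mathfrak{q}_0,\mathfrak{p}\rangle\mathfrak{q}(t)$, $t\in J^\star=\{t\in J\,|\,\langle\mathfrak{q}_0,\mathfrak{q}(t)\rangle\neq0,\ \langle\mathfrak{q}(t),\mathfrak{p}\rangle\ne0\}$.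 Dupin cyclide: an orthogonal splitting $\mathbb{R}^{4,2}=D_1\oplus_\perp D_2$ into two 3-dimensional subspaces of signature $(2,1)$; its curvature spheres are the elements of $\mathbb{P}(D_i\cap\mathcal{L})$, $i=1,2$, and its contact elements are $\mathrm{span}\{\mathfrak{s}^1,\mathfrak{s}^2\}$ with $s^i\in\mathbb{P}(D_i\cap\mathcal{L})$. Circles are included as degenerate Dupin cyclides (the case $\mathfrak{p}\in D_1$ or $\mathfrak{p}\in D_2$). A curvature line parametrization (away from singularities) of its point sphere map is a map $(u,t)\mapsto x(u,t)$ such that, for suitable curvature spheres $s^1(t)\in\mathbb{P}(D_1\cap\mathcal{L})$, $s^2(u)\in\mathbb{P}(D_2\cap\mathcal{L})$ (up to interchanging $D_1,D_2$), $x(u,t)$ is the point sphere in $\mathrm{span}\{\mathfrak{s}^1(t),\mathfrak{s}^2(u)\}$. A 2-dimensional orthogonal coordinate system of circles on a sphere is one whose two families of coordinate lines lie on circles and intersect orthogonally. *)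

(* Defs.v *)
From HB Require Import structures.
From mathcomp Require Import all_boot all_order all_algebra.
From mathcomp Require Import sesquilinear.
From mathcomp Require Import all_classical all_reals all_analysis.

Set Implicit Arguments.
Unset Strict Implicit.
Unset Printing Implicit Defensive.

Import Order.TTheory GRing.Theory Num.Theory.
Import numFieldNormedType.Exports.

Local Open Scope classical_set_scope.
Local Open Scope ring_scope.

(* Lie sphere geometry over a symmetric bilinear form b on R^6, which the
   theorem assumes to have signature (4, 2); points of the projective space are
   represented by nonzero homogeneous coordinate vectors.                     *)
Section LieSphereGeometry.
Variables (R : realType) (b : {symmetric 'rV[R]_6}).

Implicit Types (s v a r p q : 'rV[R]_6) (U M C D : {vspace 'rV[R]_6}).

(* Sylvester form: the restriction of b to U is nondegenerate, with m positive
   and n negative squares; in particular \dim U = m + n.                      *)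
Definition has_signature U (m n : nat) : Prop :=
  exists2 e : (m + n).-tuple 'rV[R]_6, basis_of U e &
    forall i j : 'I_(m + n),
      b (tnth e i) (tnth e j) =
        if i == j then (if (i < m)%N then 1 else -1) else 0.

Definition sphere s : Prop := s != 0 /\ b s s = 0.

Definition point_sphere p v : Prop := sphere v /\ b v p = 0.

Definition oriented_contact s1 s2 : Prop := b s1 s2 = 0.

(* The circle (C, C^perp); its points are the spheres contained in C. *)
Definition circle p C : Prop :=
  (forall v, v \in C -> b v p = 0) /\ has_signature C 2 1.

Definition circle_on C s : Prop := forall v, v \in C -> b v s = 0.

Definition lie_inversion a r : 'rV[R]_6 := r - (2 * b r a / b a a) *: a.

Definition msphere_pencil p s1 s2 : {vspace 'rV[R]_6} := <<[:: s1; s2; p]>>%VS.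

(* Homogeneous coordinates of a regular differentiable curve in the projective
   space: independence of c t and c' t does not depend on the choice of
   coordinates, and means that the projective curve has nonzero velocity.     *)
Definition regular_curve (J : set R) (c : R -> 'rV[R]_6) : Prop :=
  forall t, J t -> derivable c t 1 /\ free [:: c t; derive1 c t].

(* J is any open set rather than an interval: when M is degenerate, the spheres
   in M form two lines, and the spheres q t with b (q t0) (q t) != 0 all lie off
   the line of the initial sphere. The spheres of M need not all be reached.  *)
Definition pencil_parametrization M (J : set R) (q : R -> 'rV[R]_6) : Prop :=
  [/\ open J, regular_curve J q &
      forall t, J t -> q t \in M /\ sphere (q t)].

Definition circle_parametrization C (I : set R) (c : R -> 'rV[R]_6) : Prop :=
  [/\ open I, regular_curve I c &
      forall u, I u -> c u \in C /\ sphere (c u)].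

Definition evolution_vector p (q : R -> 'rV[R]_6) (t0 t : R) : 'rV[R]_6 :=
  b (q t) p *: q t0 - b (q t0) p *: q t.

Definition evolution_map p (q : R -> 'rV[R]_6) (t0 t : R) :
    'rV[R]_6 -> 'rV[R]_6 :=
  lie_inversion (evolution_vector p q t0 t).

Definition evolution_domain p (J : set R) (q : R -> 'rV[R]_6) (t0 : R) :
    set R :=
  [set t | [/\ J t, b (q t0) (q t) != 0 & b (q t) p != 0]].

Definition partial_u (x : R -> R -> 'rV[R]_6) (u t : R) : 'rV[R]_6 :=
  derive1 (fun u' => x u' t) u.

Definition partial_t (x : R -> R -> 'rV[R]_6) (u t : R) : 'rV[R]_6 :=
  derive1 (x u) t.

(* The condition free [:: x; x_u; x_t] says that the projective map is immersed
   at (u, t). It is required on a dense set of parameters only: points of the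
   initial circle lying on all spheres of the pencil stay fixed, so that their
   coordinate lines degenerate. The condition b x_u x_t = 0 is orthogonality of
   the coordinate lines: on lifts to the light cone of p^perp, b restricted to
   derivatives represents the conformal structure.                            *)
Definition orthogonal_circular_coordinates p (I J : set R)
    (x : R -> R -> 'rV[R]_6) : Prop :=
  exists s, sphere s /\
    [/\ forall u t, I u -> J t ->
          point_sphere p (x u t) /\ oriented_contact (x u t) s,
        forall t, J t -> exists C, [/\ circle p C, circle_on C s &
          forall u, I u -> x u t \in C],
        forall u, I u -> exists C, [/\ circle p C, circle_on C s &
          forall t, J t -> x u t \in C],
        forall u t, I u -> J t ->
          [/\ derivable (fun u' => x u' t) u 1, derivable (x u) t 1 &
              b (partial_u x u t) (partial_t x u t) = 0] &
        I `*` J `<=` closure [set z : R * R |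
          [/\ I z.1, J z.2 &
            free [:: x z.1 z.2; partial_u x z.1 z.2; partial_t x z.1 z.2]]]].

Definition dupin_cyclide D1 D2 : Prop :=
  [/\ has_signature D1 2 1, has_signature D2 2 1,
      forall v w, v \in D1 -> w \in D2 -> b v w = 0 &
      (D1 + D2 = fullv)%VS].

(* The condition on x u t determines it projectively: the span of s1 t and s2 u
   is totally isotropic, hence contains exactly one point sphere.             *)
Definition curvature_line_parametrization p D1 D2 (I J : set R)
    (x : R -> R -> 'rV[R]_6) : Prop :=
  exists s1 s2 : R -> 'rV[R]_6,
    [/\ regular_curve J s1 /\ (forall t, J t -> s1 t \in D1 /\ sphere (s1 t)),
        regular_curve I s2 /\ (forall u, I u -> s2 u \in D2 /\ sphere (s2 u)) &
        forall u t, I u -> J t ->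
          point_sphere p (x u t) /\ x u t \in <<[:: s1 t; s2 u]>>%VS].

End LieSphereGeometry.

(* Main.v *)
(* Let n be q_0 projected to p^perp. The vectors a_t lie in the plane M /\ p^perp,
   spanned by n and some n1 orthogonal to n, and C^perp is spanned by n, p and a
   unit vector m. For r orthogonal to n, the derivative of sigma_t r is
   sigma_t applied to a multiple of <r, n1> n.
   If <n1, m> = 0, every x(u, t) is in oriented contact with the sphere m + p;
   the t-lines lie in span(gam u, n1, n), the u-lines in sigma_t C, and the
   velocities are sigma_t gam' and a multiple of sigma_t n, hence orthogonal.
   If <n1, m> != 0, put w = m + p and D1 = span(w, n1, n). Then
   s2(u) = gam u - (<gam u, n1> / <n1, m>) w is orthogonal to D1, hence fixed by
   all sigma_t, while s1(t) = sigma_t w stays in D1, and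
   x = s2 + (<gam u, n1> / <n1, m>) s1. *)

Require Import Defs.
From HB Require Import structures.
From mathcomp Require Import all_boot all_order all_algebra.
From mathcomp Require Import sesquilinear.
From mathcomp Require Import all_classical all_reals all_analysis.
From mathcomp Require Import ring lra.

Set Implicit Arguments.
Unset Strict Implicit.
Unset Printing Implicit Defensive.

Import Order.TTheory GRing.Theory Num.Theory.
Import numFieldNormedType.Exports.

Local Open Scope classical_set_scope.
Local Open Scope ring_scope.

(** * Spans and linear relations of two or three vectors in coordinates *)

Section Free.
Variables (K : fieldType) (V : vectType K).
Implicit Types x y z : V.

Lemma span2P x y v :
  reflect (exists r s, v = r *: x + s *: y) (v \in <<[:: x; y]>>%VS).
Proof.
rewrite span_cons span_seq1.
apply: (iffP memv_addP) => [[_ /vlineP[r ->] [_ /vlineP[s ->] ->]]|[r [s ->]]].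
  by exists r, s.
by exists (r *: x); [exact: memvZ (memv_line x)|
  exists (s *: y) => //; exact: memvZ (memv_line y)].
Qed.

Lemma span3P x y z v :
  reflect (exists r s w, v = r *: x + s *: y + w *: z)
    (v \in <<[:: x; y; z]>>%VS).
Proof.
rewrite span_cons.
apply: (iffP memv_addP) => [[_ /vlineP[r ->] [_ /span2P[s [w ->]] ->]]|].
  by exists r, s, w; rewrite addrA.
case=> r [s [w ->]]; exists (r *: x); first exact: memvZ (memv_line x).
by exists (s *: y + w *: z); rewrite ?addrA//; apply/span2P; exists s, w.
Qed.

Lemma free2P x y :
  reflect (forall r s, r *: x + s *: y = 0 -> r = 0 /\ s = 0) (free [:: x; y]).
Proof.
have fP := @freeP _ _ 2 [tuple x; y]; apply: (iffP fP) => [H r s e|H k].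
  have := H (fun i => [:: r; s]`_i); rewrite !big_ord_recl big_ord0 /= addr0.
  by move=> /(_ e) k0; split; [exact: (k0 ord0)|exact: (k0 (lift ord0 ord0))].
rewrite !big_ord_recl big_ord0 /= addr0 => /H[k0 k1] i.
by case: (unliftP ord0 i) => [j ->|->//]; rewrite (ord1 j).
Qed.

Lemma free3P x y z :
  reflect (forall r s w, r *: x + s *: y + w *: z = 0 -> [/\ r = 0, s = 0 & w = 0])
    (free [:: x; y; z]).
Proof.
have fP := @freeP _ _ 3 [tuple x; y; z]; apply: (iffP fP) => [H r s w e|H k].
  have := H (fun i => [:: r; s; w]`_i).
  rewrite !big_ord_recl big_ord0 /= addr0 addrA => /(_ e) k0.
  by split; [exact: (k0 ord0)|exact: (k0 (lift ord0 ord0))|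
    exact: (k0 (lift ord0 (lift ord0 ord0)))].
rewrite !big_ord_recl big_ord0 /= addr0 addrA => /H[k0 k1 k2] i.
case: (unliftP ord0 i) => [j ->|->//]; case: (unliftP ord0 j) => [l ->|->//].
by rewrite (ord1 l).
Qed.

End Free.

(** * Differential calculus for curves of row vectors *)

Section Derivatives.
Variable R : realType.
Implicit Types (t : R).

Lemma is_derive_rVP n (f : R -> 'rV[R]_n) t df :
  is_derive t 1 f df <-> forall j, is_derive t 1 (fun t => f t 0 j) (df 0 j).
Proof.
split=> [[fd <-] j|H].
  split; first by move/derivable_mxP: fd => /(_ 0 j).
  by rewrite derive_mx// mxE.
have fd : derivable f t 1.
  by apply/derivable_mxP => i j; rewrite (ord1 i); case: (H j).
split=> //; rewrite derive_mx//; apply/rowP => j; rewrite mxE.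
by case: (H j) => _ ->.
Qed.

Lemma is_derive_scale n (c : R -> R) (f : R -> 'rV[R]_n) t dc df :
  is_derive t 1 c dc -> is_derive t 1 f df ->
  is_derive t 1 (fun t => c t *: f t) (dc *: f t + c t *: df).
Proof.
move=> cd /is_derive_rVP fd; apply/is_derive_rVP => j.
have -> : (fun t => (c t *: f t) 0 j) = c * (fun t => f t 0 j).
  by apply/funext => s; rewrite mxE.
have H := is_deriveM cd (fd j); apply: (is_derive_eq H).
by rewrite !mxE addrC; congr (_ + _); rewrite /GRing.scale/= mulrC.
Qed.

Lemma is_derive_div (f g : R -> R) t df dg : g t != 0 ->
  is_derive t 1 f df -> is_derive t 1 g dg ->
  is_derive t 1 (fun t => f t / g t) ((df * g t - f t * dg) / g t ^+ 2).
Proof.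
move=> g0 fd gd.
have gV : is_derive t 1 (fun t => (g t)^-1) (- (g t) ^- 2 *: dg).
  split; first by apply: derivableV => //; case: gd.
  by rewrite deriveV//; case: gd => ? ->.
have H := is_deriveM fd gV; apply: (is_derive_eq H).
by rewrite /GRing.scale/=; field.
Qed.

Lemma is_derive_derive1 n (f : R -> 'rV[R]_n) t :
  derivable f t 1 -> is_derive t 1 f (derive1 f t).
Proof. by move=> fd; split=> //; rewrite derive1E. Qed.

Lemma derive1_is_derive n (f : R -> 'rV[R]_n) t df :
  is_derive t 1 f df -> derive1 f t = df.
Proof. by move=> [_ <-]; rewrite derive1E. Qed.

Lemma is_derive_near0 (f : R -> R) t df :
  {near t, forall s, f s = 0} -> is_derive t 1 f df -> df = 0.
Proof.
by move=> f0 [_ <-]; rewrite -(derive_cst (V := R) 0 t 1); exact: near_eq_derive.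
Qed.

Lemma is_derive_linear n k (g : {linear 'rV[R]_n -> 'rV[R]_k})
    (f : R -> 'rV[R]_n) t df :
  is_derive t 1 f df -> is_derive t 1 (fun t => g (f t)) (g df).
Proof.
move=> /is_derive_rVP fd; apply/is_derive_rVP => j.
have gE v : g v 0 j = \sum_(i < n) g (delta_mx 0 i) 0 j * v 0 i.
  rewrite [in LHS](row_sum_delta v) linear_sum summxE.
  by apply: eq_bigr => i _; rewrite linearZ mxE mulrC.
rewrite gE; under eq_fun do rewrite gE.
rewrite -[X in is_derive _ _ X _]/(fun s => \sum_(i < n)
  (fun i s => g (delta_mx 0 i) 0 j * f s 0 i) i s) -fct_sumE.
exact: is_derive_sum.
Qed.

(** The linear map [\1 - projv U] vanishes exactly on [U]; it kills [f] near [t], hence also the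
    derivative. *)
Lemma is_derive_mem n (U : {vspace 'rV[R]_n}) (f : R -> 'rV[R]_n) t df :
  {near t, forall s, f s \in U} -> is_derive t 1 f df -> df \in U.
Proof.
move=> fU fd; have := is_derive_linear (\1 - projv U)%VF fd.
move=> /is_derive_rVP gd; suff : (\1 - projv U)%VF df = 0.
  by rewrite !lfun_simp => /eqP; rewrite subr_eq0 => /eqP dfE; rewrite [df]dfE memv_proj.
apply/rowP => j; rewrite [RHS]mxE; apply: is_derive_near0 (gd j).
by apply: filterS fU => s sU /=; rewrite !lfun_simp /= projv_id// subrr mxE.
Qed.

End Derivatives.

(** * The bilinear form, and the Lie inversions that it defines *)

Section Form.
Variables (R : realType) (b : {symmetric 'rV[R]_6}).
Implicit Types (a p v w x y z : 'rV[R]_6) (U C : {vspace 'rV[R]_6}).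

Lemma bformC x y : b x y = b y x.
Proof. by have := @hermitian_subproof R _ false idfun b x y; rewrite expr0 mul1r. Qed.

Lemma bformDl x y z : b (x + y) z = b x z + b y z.
Proof. exact: linearDl. Qed.

Lemma bformZl r x y : b (r *: x) y = r * b x y.
Proof. exact: linearZl_LR. Qed.

Lemma bformDr x y z : b z (x + y) = b z x + b z y.
Proof. by rewrite bformC bformDl !(bformC _ z). Qed.

Lemma bformZr r x y : b y (r *: x) = r * b y x.
Proof. by rewrite bformC bformZl (bformC _ y). Qed.

Lemma bformNl x y : b (- x) y = - b x y.
Proof. by rewrite -scaleN1r bformZl mulN1r. Qed.

Lemma bformNr x y : b x (- y) = - b x y.
Proof. by rewrite bformC bformNl bformC. Qed.

Lemma bform0l x : b 0 x = 0.
Proof. by rewrite -(scale0r 0) bformZl mul0r. Qed.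

Lemma bform0r x : b x 0 = 0.
Proof. by rewrite bformC bform0l. Qed.

Lemma bform_suml I (s : seq I) (P : pred I) (F : I -> 'rV[R]_6) y :
  b (\sum_(i <- s | P i) F i) y = \sum_(i <- s | P i) b (F i) y.
Proof.
exact: (big_morph (fun x => b x y) (fun u v => bformDl u v y) (bform0l y)).
Qed.

Definition bformE := (bformDl, bformDr, bformNl, bformNr, bformZl, bformZr, bform0l, bform0r).

(** Expanding [f] in the standard basis reduces the claim to the product rule for real functions;
    [forml] differentiates the cofactors [b (g s) (delta_mx 0 i)]. *)
Lemma is_derive_form (f g : R -> 'rV[R]_6) (t : R) df dg :
  is_derive t 1 f df -> is_derive t 1 g dg ->
  is_derive t 1 (fun t => b (f t) (g t)) (b df (g t) + b (f t) dg).
Proof.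
have forml (h : R -> 'rV[R]_6) (s : R) dh w : is_derive s 1 h dh ->
    is_derive s 1 (fun s => b (h s) w) (b dh w).
  move=> /is_derive_rVP hd.
  have E v : b v w = \sum_(i < 6) b (delta_mx 0 i) w * v 0 i.
    rewrite [in LHS](row_sum_delta v) bform_suml.
    by apply: eq_bigr => i _; rewrite bformZl mulrC.
  rewrite E; under eq_fun do rewrite E.
  by rewrite -fct_sumE; apply: is_derive_sum => i.
move=> fd gd; have /is_derive_rVP fd' := fd.
have E v w : b v w = \sum_(i < 6) v 0 i * b w (delta_mx 0 i).
  rewrite [in LHS](row_sum_delta v) bform_suml.
  by apply: eq_bigr => i _; rewrite bformZl bformC.
rewrite (E df) (E (f t) dg) -big_split/=; under eq_fun do rewrite E.
pose F i (s : R) := f s 0 i * b (g s) (delta_mx 0 i).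
rewrite -[X in is_derive _ _ X _]/(fun s => \sum_(i < 6) F i s) -fct_sumE.
have Fd i : is_derive t 1 (F i)
    (df 0 i * b (g t) (delta_mx 0 i) + f t 0 i * b dg (delta_mx 0 i)).
  have H := is_deriveM (fd' i) (forml _ _ _ (delta_mx 0 i) gd).
  by apply: (is_derive_eq H); rewrite /GRing.scale/= addrC mulrC.
exact: is_derive_sum.
Qed.

Section Inversion.
Variable a : 'rV[R]_6.
Hypothesis a0 : b a a != 0.
Local Notation sig := (lie_inversion b a).

Lemma lie_inversionD x y : sig (x + y) = sig x + sig y.
Proof.
by apply/rowP => j; rewrite /lie_inversion !mxE !bformE; field.
Qed.

Lemma lie_inversionZ r x : sig (r *: x) = r *: sig x.
Proof.
by apply/rowP => j; rewrite /lie_inversion !mxE !bformE; field.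
Qed.

Lemma lie_inversion0 : sig 0 = 0.
Proof. by rewrite /lie_inversion bform0l mulr0 mul0r scale0r subr0. Qed.

Lemma lie_inversion_fix x : b x a = 0 -> sig x = x.
Proof. by rewrite /lie_inversion => ->; rewrite mulr0 mul0r scale0r subr0. Qed.

Lemma lie_inversion_self_adjoint x y : b (sig x) y = b x (sig y).
Proof. by rewrite /lie_inversion !bformE (bformC a y); field. Qed.

Lemma lie_inversionK : involutive sig.
Proof.
by move=> x; apply/rowP => j; rewrite /lie_inversion !mxE !bformE; field.
Qed.

Lemma lie_inversion_isometry x y : b (sig x) (sig y) = b x y.
Proof. by rewrite lie_inversion_self_adjoint lie_inversionK. Qed.

Lemma lie_inversion_eq0 x : sig x = 0 -> x = 0.
Proof. by move/(congr1 sig); rewrite lie_inversionK lie_inversion0. Qed.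

End Inversion.

(* The derivative of t |-> sigma_(a t) v, pulled back by sigma_(a t). *)
Definition inversion_velocity a da v : 'rV[R]_6 :=
  - (2 / b a a) *: (b v a *: da - b v da *: a).

Lemma is_derive_lie_inversion (f : R -> 'rV[R]_6) (t : R) df (r : 'rV[R]_6) :
  b (f t) (f t) != 0 -> is_derive t 1 f df ->
  is_derive t 1 (fun t => lie_inversion b (f t) r)
    (lie_inversion b (f t) (inversion_velocity (f t) df r)).
Proof.
move=> f0 fd.
have rf : is_derive t 1 (fun t => b r (f t)) (b r df).
  have H := is_derive_form (is_derive_cst r t 1) fd.
  by apply: (is_derive_eq H); rewrite bform0l add0r.
have rf2 : is_derive t 1 (fun t => 2 * b r (f t)) (2 * b r df).
  exact: (is_deriveZ 2 rf).
have H := is_deriveB (is_derive_cst r t 1)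
  (is_derive_scale (is_derive_div f0 rf2 (is_derive_form fd fd)) fd).
apply: (is_derive_eq H); apply/rowP => j.
rewrite /inversion_velocity /lie_inversion !mxE !bformE (bformC df (f t)).
by field.
Qed.

End Form.
Arguments bformC {R b}.

(** * Subspaces of signature (2, 1) and orthogonal frames *)

Section Signature.
Variables (R : realType) (b : {symmetric 'rV[R]_6}).
Implicit Types (p v w x y z : 'rV[R]_6) (U C D : {vspace 'rV[R]_6}).

Definition frame21 x y z :=
  [/\ b x x = 1, b y y = 1 & b z z = -1] /\ [/\ b x y = 0, b x z = 0 & b y z = 0].

Lemma has_signature21E U : has_signature b U 2 1 ->
  exists x y z, U = <<[:: x; y; z]>>%VS /\ frame21 x y z.
Proof.
case=> e /andP[/eqP Ue _] eb.
exists (tnth e ord0), (tnth e (inord 1)), (tnth e (inord 2)); split; last first.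
  by split; rewrite !eb -?val_eqE/= ?inordK.
rewrite -Ue; congr (<<_>>)%VS; apply: (@eq_from_nth _ 0); rewrite size_tuple// => i.
have nthE k (k3 : (k < 3)%N) : e`_k = tnth e (inord k).
  by rewrite (tnth_nth 0) inordK.
case: i => [|[|[|//]]] _ /=; rewrite nthE//.
by congr (tnth e _); apply/val_inj; rewrite /= inordK.
Qed.

(** A frame is free, because pairing a linear relation with its members isolates the coefficients;
    the upper bound on the dimension makes it a basis. *)
Lemma has_signature21I U x y z : frame21 x y z -> (\dim U <= 3)%N ->
  x \in U -> y \in U -> z \in U -> has_signature b U 2 1.
Proof.
move=> [[xx yy zz] [xy xz yz]] dU xU yU zU.
exists [tuple x; y; z].
  rewrite basisEfree; apply/and3P; split=> //.
    apply/free3P => r s w rsw.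
    have := congr1 (b x) rsw; have := congr1 (b y) rsw.
    have := congr1 (b z) rsw.
    rewrite !bformE (bformC z x) (bformC z y) (bformC y x) xx yy zz xy xz yz.
    by move=> *; split; lra.
  by apply/span_subvP => v; rewrite !inE => /or3P[] /eqP ->.
move=> [i i3] [j j3]; rewrite !(tnth_nth 0) -val_eqE /=.
case: i i3 => [|[|[|//]]] _; case: j j3 => [|[|[|//]]] _ //=.
all: by rewrite bformC.
Qed.

Lemma has_signature21_dim U : has_signature b U 2 1 -> \dim U = 3.
Proof. by case=> e /size_basis. Qed.

Lemma has_signature21_nondegenerate U v : has_signature b U 2 1 ->
  v \in U -> (forall w, w \in U -> b v w = 0) -> v = 0.
Proof.
move=> /has_signature21E[x [y [z [-> [[xx yy zz] [xy xz yz]]]]]].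
move=> /span3P[r [s [w ->]]] H.
have mem i : (i < 3)%N -> [:: x; y; z]`_i \in <<[:: x; y; z]>>%VS.
  by move=> i3; apply/memv_span/mem_nth.
have := H _ (mem 0 isT); have := H _ (mem 1 isT); have := H _ (mem 2 isT).
rewrite /= !bformE (bformC z x) (bformC z y) (bformC y x) xx yy zz xy xz yz => *.
have -> : r = 0 by lra.
have -> : s = 0 by lra.
have -> : w = 0 by lra.
by rewrite !scale0r !addr0.
Qed.

(** Removing a multiple of [x] from [y] and rescaling gives a null vector [h] with [b h x = 1]. Then
    [h + x/2] and [h - x/2] are orthogonal with squares 1 and -1, and [z] only has to be
    normalized. *)
Lemma has_signature21_hyperbolic x y z :
  b x x = 0 -> b x y != 0 -> 0 < b z z -> b z x = 0 -> b z y = 0 ->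
  has_signature b <<[:: x; y; z]>>%VS 2 1.
Proof.
move=> xx xy zz zx zy.
pose h := (b x y)^-1 *: (y - (b y y / (2 * b x y)) *: x).
have hh : b h h = 0.
  by rewrite /h !bformE xx (bformC y x); field.
have hx : b h x = 1.
  by rewrite /h !bformE xx (bformC y x); field.
have hz : b h z = 0.
  by rewrite /h !bformE !(bformC _ z) zx zy; field.
have [u u0 uu] : exists2 u, u != 0 & u ^+ 2 = b z z.
  by exists (Num.sqrt (b z z)); rewrite ?sqr_sqrtr ?sqrtr_eq0 -?ltNge// ltW.
have mx : x \in <<[:: x; y; z]>>%VS by apply: memv_span; rewrite inE eqxx.
have my : y \in <<[:: x; y; z]>>%VS by apply: memv_span; rewrite !inE eqxx orbT.
have mz : z \in <<[:: x; y; z]>>%VS by apply: memv_span; rewrite !inE eqxx !orbT.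
have mh : h \in <<[:: x; y; z]>>%VS by rewrite memvZ// memvB// memvZ.
clearbody h.
apply: (@has_signature21I _ (h + 2^-1 *: x) (u^-1 *: z) (h - 2^-1 *: x)).
- have xh : b x h = 1 by rewrite bformC.
  have xz : b x z = 0 by rewrite bformC.
  have zh : b z h = 0 by rewrite bformC.
  by split; split; rewrite !bformE ?hh ?hx ?xh ?xx ?zh ?hz ?zx ?xz -?uu; field.
- exact: dim_span.
- by rewrite memvD// memvZ.
- by rewrite memvZ.
- by rewrite memvB// memvZ.
Qed.

(** Six pairwise orthogonal vectors of nonzero square are free, hence span the whole space, and the
    coordinates of [v] are its products with them up to nonzero factors. *)
Lemma orthogonal_family_eq0 (e : 'I_6 -> 'rV[R]_6) v :
  (forall i, b (e i) (e i) != 0) -> (forall i j, i != j -> b (e i) (e j) = 0) ->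
  (forall i, b v (e i) = 0) -> v = 0.
Proof.
move=> e0 eo ve.
have ef : free [tuple e i | i < 6].
  apply/freeP => k k0 i; have := congr1 (b (e i)) k0.
  rewrite bformC bform_suml bform0r (bigD1 i)//= big1 ?addr0 => [|j ji].
    rewrite (nth_map i) ?size_enum_ord// nth_ord_enum bformE => /eqP.
    by rewrite mulf_eq0 (negbTE (e0 i)) orbF => /eqP.
  by rewrite (nth_map i) ?size_enum_ord// nth_ord_enum bformE eo ?mulr0.
have : v \in <<[tuple e i | i < 6]>>%VS.
  have -> : <<[tuple e i | i < 6]>>%VS = fullv.
    apply/eqP; rewrite eqEdim subvf/= dimvf (eqnP ef) size_tuple.
    by rewrite dim_matrix.
  exact: memvf.
move/coord_span => vE; have cv i : coord [tuple e i | i < 6] i v = 0.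
  have := ve i; rewrite vE bform_suml (bigD1 i)//= big1 ?addr0 => [|j ji].
    rewrite (nth_map i) ?size_enum_ord// nth_ord_enum bformE => /eqP.
    by rewrite -vE mulf_eq0 (negbTE (e0 i)) orbF => /eqP.
  by rewrite (nth_map i) ?size_enum_ord// nth_ord_enum bformE eo ?mulr0.
by rewrite vE; apply: big1 => i _; rewrite cv scale0r.
Qed.

(* A vector of a positive definite 4-space orthogonal to x, y and n keeps a
   positive square when projected off the negative vectors z and p. *)
Lemma orthogonal_complement x y z n p : has_signature b fullv 4 2 ->
  frame21 x y z -> 0 < b n n -> b p p = -1 ->
  [/\ b x n = 0, b y n = 0, b z n = 0 & b n p = 0] ->
  [/\ b x p = 0, b y p = 0 & b z p = 0] ->
  exists m, b m m = 1 /\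
    [/\ b x m = 0, b y m = 0, b z m = 0, b n m = 0 & b m p = 0].
Proof.
move=> [e _ eb] [[xx yy zz] [xy xz yz]] nn pp [xn yn zn np] [xp yp zp].
pose f (i : 'I_4) := tnth e (widen_ord (leqnSn 4 : (4 <= 4 + 2)%N) i).
have fb i j : b (f i) (f j) = (i == j)%:R.
  by rewrite eb -val_eqE/= (ltn_ord i) val_eqE; case: (_ == _).
(* The entries of a row in the left kernel of [A] combine the [f i] into a vector orthogonal to [x],
   [y] and [n]. A nonzero one exists because [A] has four rows and three columns. *)
pose A := \matrix_(i < 4, j < 3) b (f i) [:: x; y; n]`_j.
pose k := nz_row (kermx A).
have k0 : k != 0.
  rewrite nz_row_eq0 -mxrank_eq0 mxrank_ker -lt0n subn_gt0.
  exact: leq_ltn_trans (rank_leq_col A) _.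
have kA : k *m A = 0 by apply/sub_kermxP; exact: nz_row_sub.
pose v := \sum_i k 0 i *: f i.
have vA j (j3 : (j < 3)%N) : b v [:: x; y; n]`_j = 0.
  have := congr1 (fun M : 'rV_3 => M 0 (Ordinal j3)) kA; rewrite !mxE => <-.
  by rewrite bform_suml; apply: eq_bigr => i _; rewrite bformZl !mxE.
have vx : b v x = 0 := vA 0 isT; have vy : b v y = 0 := vA 1 isT.
have vn : b v n = 0 := vA 2 isT.
have vv : b v v = \sum_i k 0 i ^+ 2.
  rewrite [in LHS]bform_suml; apply: eq_bigr => i _.
  rewrite bformZl bformC bform_suml (bigD1 i)//= big1 ?addr0 => [|j ji].
    by rewrite bformZl fb eqxx mulr1.
  by rewrite bformZl fb (negbTE ji) mulr0.
have vv0 : 0 < b v v.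
  rewrite vv lt_def sumr_ge0 ?andbT => [|i _]; last exact: sqr_ge0.
  apply: contra_neq k0 => /psumr_eq0P k0; apply/rowP => i; rewrite mxE.
  by apply/eqP; rewrite -sqrf_eq0 k0// => j _; exact: sqr_ge0.
clearbody v; pose w := v + b v z *: z + b v p *: p.
have ww : 0 < b w w.
  have -> : b w w = b v v + b v z ^+ 2 + b v p ^+ 2.
    rewrite /w !bformE (bformC z v) (bformC p v) (bformC p z) zz zp pp.
    by ring.
  by rewrite -addrA ltr_wpDr// addr_ge0// sqr_ge0.
have [u u0 uu] : exists2 u, u != 0 & u ^+ 2 = b w w.
  by exists (Num.sqrt (b w w)); rewrite ?sqr_sqrtr ?sqrtr_eq0 -?ltNge// ltW.
exists (u^-1 *: w); split; first by rewrite !bformZl bformZr -uu; field.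
have [xv yv nv] : [/\ b x v = 0, b y v = 0 & b n v = 0].
  by split; rewrite bformC.
have nz : b n z = 0 by rewrite bformC.
have [zv pv pz] : [/\ b z v = b v z, b p v = b v p & b p z = 0].
  by split; rewrite bformC.
by split; rewrite /w !bformE
  ?(xz, yz, zz, xp, yp, zp, np, pp, nz, xv, yv, nv, zv, pv, pz); ring.
Qed.


End Signature.

(** * Circles and their regular parametrizations *)

Section Circle.
Variables (R : realType) (b : {symmetric 'rV[R]_6}) (C : {vspace 'rV[R]_6}).
Hypothesis sigC : has_signature b C 2 1.
Implicit Types (v w : 'rV[R]_6).

(** A form with a single negative square has no totally isotropic plane. In coordinates this is the
    equality case of Cauchy-Schwarz for [(v1, v2)] and [(w1, w2)], which makes [w3 *: v - v3 *: w]
    vanish. *)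
Lemma null_orthogonal_not_free v w : v \in C -> w \in C ->
  b v v = 0 -> b w w = 0 -> b v w = 0 -> ~~ free [:: v; w].
Proof.
have [x [y [z [-> [[xx yy zz] [xy xz yz]]]]]] := has_signature21E sigC.
move=> /span3P[v1 [v2 [v3 ->]]] /span3P[w1 [w2 [w3 ->]]].
rewrite !bformE (bformC z x) (bformC z y) (bformC y x) xx yy zz xy xz yz => vv ww vw.
have e1 : v1 ^+ 2 + v2 ^+ 2 = v3 ^+ 2 by lra.
have e2 : w1 ^+ 2 + w2 ^+ 2 = w3 ^+ 2 by lra.
have e3 : v1 * w1 + v2 * w2 = v3 * w3 by lra.
have : (w3 * v1 - v3 * w1) ^+ 2 + (w3 * v2 - v3 * w2) ^+ 2 = 0.
  transitivity (w3 ^+ 2 * (v1 ^+ 2 + v2 ^+ 2) + v3 ^+ 2 * (w1 ^+ 2 + w2 ^+ 2)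
     - 2 * v3 * w3 * (v1 * w1 + v2 * w2)); first by ring.
  by rewrite e1 e2 e3; ring.
move=> /eqP; rewrite paddr_eq0 ?sqr_ge0// !sqrf_eq0 !subr_eq0 => /andP[/eqP h1 /eqP h2].
apply/negP => /free2P fvw; have [|w30 v30] := fvw w3 (- v3).
  transitivity ((w3 * v1 - v3 * w1) *: x + (w3 * v2 - v3 * w2) *: y).
    by apply/rowP => j; rewrite !mxE; ring.
  by rewrite h1 h2 !subrr !scale0r addr0.
(* The relation found is trivial only for [v3 = w3 = 0]; then [v] itself is zero, and the
   coefficients 1 and 0 give a nontrivial relation. *)
have v30' : v3 = 0 by lra.
have v0 : v1 = 0 /\ v2 = 0.
  move/eqP: e1; rewrite v30' expr0n/= paddr_eq0 ?sqr_ge0// !sqrf_eq0.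
  by move=> /andP[/eqP -> /eqP ->].
have [|+ _] := fvw 1 0.
  by case: v0 => -> ->; rewrite v30' !scale0r !addr0 scaler0.
by move/eqP; rewrite oner_eq0.
Qed.

Variables (I : set R) (gam : R -> 'rV[R]_6).
Hypothesis param : circle_parametrization b C I gam.

Lemma circle_parametrization_derive u : I u ->
  [/\ is_derive u 1 gam (derive1 gam u), derive1 gam u \in C,
      b (gam u) (derive1 gam u) = 0 & free [:: gam u; derive1 gam u]].
Proof.
case: param => oI reg mem Iu; have [/is_derive_derive1 gd fg] := reg u Iu.
have nI : nbhs u I by exact: open_nbhs_nbhs.
split=> //.
  by apply: is_derive_mem gd; apply: filterS nI => s /mem[].
suff : b (derive1 gam u) (gam u) + b (gam u) (derive1 gam u) = 0.
  by rewrite (bformC (derive1 _ _)); lra.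
apply: is_derive_near0 (is_derive_form b gd gd).
by apply: filterS nI => s /mem[_ []].
Qed.

(* Were gam orthogonal to v near u, then v, being orthogonal to gam u and gam' u,
   would be a multiple of gam u; near u, gam would then be null and orthogonal to
   the null vector v, hence confined to the line of v, against regularity. *)
Lemma circle_parametrization_dense v (A : set R) u : v \in C -> v != 0 ->
  I u -> nbhs u A -> exists s, [/\ A s, I s & b (gam s) v != 0].
Proof.
move=> vC v0 Iu nA; case: (param) => oI _ mem; apply: contrapT => noex.
have nI : nbhs u I by exact: open_nbhs_nbhs.
have ng : {near u, forall s, b (gam s) v = 0}.
  have nAI : nbhs u (A `&` I) by exact: filterI.
  apply: filterS nAI => s [As Is]; apply/eqP; apply: contrapT => /negP gv.
  by apply: noex; exists s.
have [gd dC gdg fg] := circle_parametrization_derive Iu.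
have gv : b (gam u) v = 0 by exact: nbhs_singleton ng.
have dv : b (derive1 gam u) v = 0.
  have := is_derive_form b gd (is_derive_cst v u 1).
  by rewrite bform0r addr0; exact: is_derive_near0.
have [guC [gu0 guu]] := mem u Iu.
have dd : b (derive1 gam u) (derive1 gam u) != 0.
  apply: contraTneq fg => dd0; exact: null_orthogonal_not_free.
(* Otherwise [v], [gam u] and the derivative form a basis of the 3-dimensional [C], and [gam u] is
   orthogonal to all of it, against nondegeneracy. *)
have /span2P[r [s vE]] : v \in <<[:: gam u; derive1 gam u]>>%VS.
  apply: contrapT => /negP vN.
  have f3 : free [:: v; gam u; derive1 gam u] by rewrite free_cons vN.
  have CE : <<[:: v; gam u; derive1 gam u]>>%VS = C.
    apply/eqP; rewrite eqEdim (eqnP f3) (has_signature21_dim sigC) leqnn andbT.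
    by apply/span_subvP => w; rewrite !inE => /or3P[] /eqP ->.
  move/eqP: gu0; apply; apply: (has_signature21_nondegenerate sigC guC) => w.
  rewrite -CE => /span3P[r [s [t ->]]].
  by rewrite !bformE gv guu gdg; ring.
have s0 : s = 0.
  move: dv; rewrite {1}vE !bformE (bformC _ (gam u)) gdg mulr0 add0r => /eqP.
  by rewrite mulf_eq0 (negbTE dd) orbF => /eqP.
have vv : b v v = 0 by rewrite vE s0 !bformE guu; ring.
have gL : {near u, forall s, gam s \in <[v]>%VS}.
  have nI' : nbhs u (I `&` [set s | b (gam s) v = 0]) by exact: filterI.
  apply: filterS nI' => s' [Is gs].
  have [gC [g0 gg]] := mem s' Is.
  have := null_orthogonal_not_free gC vC gg vv gs.
  by rewrite free_cons seq1_free v0 andbT negbK span_seq1.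
have /vlineP[r1 dE] := is_derive_mem gL gd.
have /vlineP[r2 gE] : gam u \in <[v]>%VS by exact: nbhs_singleton gL.
have [|r10 r20] := free2P _ _ fg r1 (- r2).
  by rewrite dE gE !scalerA mulNr mulrC scaleNr subrr.
have r2E : r2 = 0 by lra.
by move: gu0; rewrite gE r2E scale0r eqxx.
Qed.

End Circle.

(** * M-sphere pencils and the vectors of their evolution maps *)

Section Evolution.
Variables (R : realType) (b : {symmetric 'rV[R]_6}).
Variable p : 'rV[R]_6.
Hypothesis pp : b p p = -1.
Implicit Types (a n v w : 'rV[R]_6) (U M C : {vspace 'rV[R]_6}).

(** Let [s1'], [s2'] be the projections of [s1], [s2] to the complement of [p]. Then
    [n = l1 s1' + l2 s2'] is completed by [h = l2 s1' - l1 s2']: the determinant is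
    [l1 ^+ 2 + l2 ^+ 2] up to sign, so nonzero. A Gram-Schmidt step turns [h] into [n1]. *)
Lemma pencil_point_complex s1 s2 n : n \in msphere_pencil p s1 s2 ->
  b n p = 0 -> b n n != 0 ->
  exists n1, [/\ b n1 p = 0, b n1 n = 0 & forall a, a \in msphere_pencil p s1 s2 ->
    b a p = 0 -> a \in <<[:: n; n1]>>%VS].
Proof.
move=> /span3P[l1 [l2 [l3 nE]]] np nn.
have l3E : l3 = l1 * b s1 p + l2 * b s2 p.
  by move: np; rewrite nE !bformE pp; lra.
have d0 : l1 ^+ 2 + l2 ^+ 2 != 0.
  apply: contra_neq nn => /eqP; rewrite paddr_eq0 ?sqr_ge0// !sqrf_eq0.
  move=> /andP[/eqP l10 /eqP l20].
  by rewrite nE l3E l10 l20 !bformE; ring.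
pose h := l2 *: (s1 + b s1 p *: p) - l1 *: (s2 + b s2 p *: p).
exists (h - (b h n / b n n) *: n); split.
- by rewrite /h !bformE pp np; ring.
- by rewrite bformDl bformNl bformZl; field.
move=> a /span3P[m1 [m2 [m3 aE]]] ap.
have m3E : m3 = m1 * b s1 p + m2 * b s2 p.
  by move: ap; rewrite aE !bformE pp; lra.
pose be := (m1 * l2 - m2 * l1) / (l1 ^+ 2 + l2 ^+ 2).
apply/span2P.
exists ((m1 * l1 + m2 * l2) / (l1 ^+ 2 + l2 ^+ 2) + be * (b h n / b n n)), be.
move: (b h n / b n n) => c; apply/rowP => j.
by rewrite aE nE m3E l3E /be /h !mxE; field.
Qed.

(** The velocity is an infinitesimal rotation in the plane of [a] and [da]. Expressed through [n]
    and [n1] it is a multiple of [b v n1 *: n - b v n *: n1], whose factor contains the determinant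
    of the coordinates of [a] and [da]. *)
Lemma inversion_velocity_pencil a da n n1 :
  a \in <<[:: n; n1]>>%VS -> da \in <<[:: n; n1]>>%VS -> b a a != 0 ->
  free [:: a; da] ->
  exists2 d : R, d != 0 & forall v, b v n = 0 ->
    inversion_velocity b a da v = (d * b v n1) *: n.
Proof.
move=> /span2P[r [s aE]] /span2P[r' [s' daE]] aa fa.
exists (- (2 / b a a) * (s * r' - s' * r)).
  rewrite mulf_neq0 ?oppr_eq0 ?mulf_neq0 ?invr_eq0 ?pnatr_eq0//.
  (* Were the determinant zero, independence of [a] and [da] would force [s = s' = 0], then [r = 0],
     so that [a] would vanish. *)
  apply/negP => /eqP D.
  have [|rs0 s0] := free2P _ _ fa s' (- s).
    transitivity ((s' * r - s * r') *: n).
      by apply/rowP => j; rewrite aE daE !mxE; ring.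
    have -> : s' * r - s * r' = 0 by lra.
    by rewrite scale0r.
  have {}s0 : s = 0 by lra.
  have [|r0 r10] := free2P _ _ fa r' (- r).
    by rewrite aE daE s0 rs0; apply/rowP => j; rewrite !mxE; ring.
  have {}r10 : r = 0 by lra.
  by move: aa; rewrite aE s0 r10 !scale0r addr0 bform0l eqxx.
move=> v vn; rewrite /inversion_velocity; move: (2 / b a a) => c.
by apply/rowP => j; rewrite aE daE !mxE !bformE vn; ring.
Qed.

(* a is the image of q under a linear map with kernel span(q t0), and q t0 is not
   in span(q t, q' t) since q t is orthogonal to that span. *)
Lemma evolution_vector_regular s1 s2 (J : set R) (q : R -> 'rV[R]_6) t0 t :
  let M := msphere_pencil p s1 s2 in
  let a := evolution_vector b p q t0 in
  pencil_parametrization b M J q -> J t0 -> b (q t0) p != 0 ->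
  evolution_domain b p J q t0 t ->
  [/\ b (a t) (a t) != 0, b (a t) p = 0, a t \in M &
    exists da, [/\ is_derive t 1 a da, b da p = 0, da \in M & free [:: a t; da]]].
Proof.
move=> M a [oJ reg mem] Jt0 k0 [Jt q0q kt].
have [q0M [_ q00]] := mem _ Jt0; have [qM [_ qq]] := mem _ Jt.
have [/is_derive_derive1 qd fq] := reg _ Jt.
have nJ : nbhs t J by exact: open_nbhs_nbhs.
have q'M : derive1 q t \in M by apply: is_derive_mem qd; apply: filterS nJ => s /mem[].
have qq' : b (q t) (derive1 q t) = 0.
  suff : b (derive1 q t) (q t) + b (q t) (derive1 q t) = 0.
    by rewrite (bformC (derive1 _ _)); lra.
  apply: is_derive_near0 (is_derive_form b qd qd).
  by apply: filterS nJ => s /mem[_ []].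
split.
(* Both spheres are null, so only the mixed term survives; the conditions defining the evolution
   domain make it nonzero. *)
- have -> : b (a t) (a t) = - 2 * b (q t) p * b (q t0) p * b (q t0) (q t).
    rewrite /a /evolution_vector !bformE (bformC (q t) (q t0)) q00 qq.
    by ring.
  by rewrite !mulf_neq0// oppr_eq0 pnatr_eq0.
- by rewrite /a /evolution_vector !bformE; ring.
- by rewrite memvB// memvZ.
exists (b (derive1 q t) p *: q t0 - b (q t0) p *: derive1 q t); split.
- have H := is_deriveB
    (is_derive_scale (is_derive_form b qd (is_derive_cst p t 1))
      (is_derive_cst (q t0) t 1))
    (is_derive_scale (is_derive_cst (b (q t0) p) t 1) qd).
  by apply: (is_derive_eq H); rewrite bform0r scaler0 scale0r !addr0 add0r.
- by rewrite !bformE; ring.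
- by rewrite memvB// memvZ.
apply/free2P => r s; rewrite /a /evolution_vector => E.
have c0 : r * b (q t) p + s * b (derive1 q t) p = 0.
  have := congr1 (b (q t)) E; rewrite !bformE qq qq' (bformC (q t) (q t0)).
  rewrite !(mulr0, subr0) !mulrA -mulrDl => /eqP.
  by rewrite mulf_eq0 (negbTE q0q) orbF => /eqP.
have [|r0 s0] := free2P _ _ fq r s; last by split.
apply/eqP; rewrite -(inj_eq (scalerI k0)) scaler0.
apply/eqP; rewrite -[RHS]oppr0 -[in RHS]E.
transitivity (b (q t0) p *: (r *: q t + s *: derive1 q t)
   - (r * b (q t) p + s * b (derive1 q t) p) *: q t0).
  by rewrite c0 scale0r subr0.
by apply/rowP => j; rewrite !mxE; ring.
Qed.

End Evolution.

(** * The surface swept out by a circle, with [n], [m], [p] an orthogonal basis of the complement of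
    [C] *)

Section Surface.
Variables (R : realType) (b : {symmetric 'rV[R]_6}).
Variables (p n m n1 : 'rV[R]_6) (C : {vspace 'rV[R]_6}).
Hypothesis pp : b p p = -1.
Hypothesis mm : b m m = 1.
Hypothesis nn : 0 < b n n.
Hypothesis np : b n p = 0.
Hypothesis mp : b m p = 0.
Hypothesis nm : b n m = 0.
Hypothesis sigC : has_signature b C 2 1.
Hypothesis Cp : forall v, v \in C -> b v p = 0.
Hypothesis Cn : forall v, v \in C -> b v n = 0.
Hypothesis Cm : forall v, v \in C -> b v m = 0.
Hypothesis CP : forall v, b v p = 0 -> b v n = 0 -> b v m = 0 -> v \in C.
Hypothesis n1p : b n1 p = 0.
Hypothesis n1n : b n1 n = 0.
Variables (I J : set R) (gam a : R -> 'rV[R]_6).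
Hypothesis param : circle_parametrization b C I gam.
Hypothesis areg : forall t, J t ->
  [/\ b (a t) (a t) != 0, a t \in <<[:: n; n1]>>%VS &
    exists da, [/\ is_derive t 1 a da, da \in <<[:: n; n1]>>%VS & free [:: a t; da]]].
Implicit Types (u t : R) (v c : 'rV[R]_6).
Local Notation sig t := (lie_inversion b (a t)).

Let gamC u : I u -> gam u \in C.
Proof. by case: param => _ _ mem /mem[]. Qed.

Let gam0 u : I u -> gam u != 0.
Proof. by case: param => _ _ mem /mem[_ []]. Qed.

Let gamgam u : I u -> b (gam u) (gam u) = 0.
Proof. by case: param => _ _ mem /mem[_ []]. Qed.

Let aa t : J t -> b (a t) (a t) != 0.
Proof. by case/areg. Qed.

Let fixed t v : J t -> b v n = 0 -> b v n1 = 0 -> sig t v = v.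
Proof.
move=> /areg[_ /span2P[r [s aE]] _] vn vn1; apply: lie_inversion_fix.
by rewrite aE !bformE vn vn1; ring.
Qed.

(** [p] is orthogonal to [n] and [n1]: the inversions are M-Lie inversions and so preserve point
    spheres. *)
Let sigp t : J t -> sig t p = p.
Proof. by move=> Jt; apply: fixed; rewrite // bformC. Qed.

Let point u t : I u -> J t -> point_sphere b p (sig t (gam u)).
Proof.
move=> Iu Jt; split; first split.
- apply: contra_neq (gam0 Iu); exact/lie_inversion_eq0/aa.
- by rewrite lie_inversion_isometry ?aa// gamgam.
- by rewrite lie_inversion_self_adjoint ?aa// sigp// Cp// gamC.
Qed.

Let sig_mem t v : J t -> sig t v \in <<[:: v; n1; n]>>%VS.
Proof.
move=> /areg[_ /span2P[r [s aE]] _]; rewrite /lie_inversion.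
move: (2 * _ / _) => c; rewrite aE; apply/span3P; exists 1, (- (c * s)), (- (c * r)).
by apply/rowP => j; rewrite !mxE; ring.
Qed.

(** The factor [d] depends on [t] alone and is common to all [v]; that it is nonzero yields the
    regularity of the [t]-lines and of [s1] below. *)
Let sig_derive t : J t -> exists2 d : R, d != 0 & forall v, b v n = 0 ->
  is_derive t 1 (fun t => sig t v) (sig t ((d * b v n1) *: n)).
Proof.
move=> Jt; have [at0 aN [da [ad daN fa]]] := areg Jt.
have [d d0 dv] := inversion_velocity_pencil aN daN at0 fa.
by exists d => // v vn; rewrite -dv//; exact: is_derive_lie_inversion.
Qed.

(** * The case of a Dupin cyclide *)

Section Cyclide.
Hypothesis k0 : b n1 m != 0.
Local Notation w := (m + p).
(** The multiple of [w] is chosen to make [g v] orthogonal to [n1], as [b w n1 = b n1 m]. The second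
    space of the splitting is the image of [C] under [g]. *)
Let g v := v - (b v n1 / b n1 m) *: w.
Local Notation D1 := (<<[:: w; n1; n]>>%VS).

Let ww : b w w = 0.
Proof. by rewrite !bformE mm pp (bformC p m) mp; ring. Qed.

Let wn : b w n = 0.
Proof. by rewrite bformDl (bformC m) (bformC p) nm np addr0. Qed.

Let wn1 : b w n1 = b n1 m.
Proof. by rewrite bformDl (bformC m) (bformC p) n1p addr0. Qed.

Let wp : b w p = -1.
Proof. by rewrite bformDl mp pp add0r. Qed.

Let Cw c : c \in C -> b c w = 0.
Proof. by move=> cC; rewrite bformDr Cm// Cp// addr0. Qed.

(** [w] is null and orthogonal to [C], so adding multiples of it to vectors of [C] changes no
    product. *)
Let g_isometry c c' : c \in C -> c' \in C -> b (g c) (g c') = b c c'.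
Proof.
rewrite /g => /Cw cw /Cw c'w; have := ww; move: (_ + p) cw c'w => w' cw c'w w'w'.
by rewrite !bformE cw (bformC w' c') c'w w'w'; ring.
Qed.

Let g_orthogonal c v : c \in C -> v \in D1 -> b (g c) v = 0.
Proof.
move=> cC /span3P[r [s [t ->]]]; have cw := Cw cC; have cn := Cn cC.
move: ww wn wn1 cw; rewrite /g; move: (m + p) => w' w'w' w'n w'n1 cw.
by rewrite !bformE cw cn w'w' w'n w'n1; field.
Qed.

Let g_linear r s c c' : g (r *: c + s *: c') = r *: g c + s *: g c'.
Proof.
by rewrite /g; move: (m + p) => w'; apply/rowP => j; rewrite !mxE !bformE; field.
Qed.

(** Since [b p c = 0] and [b p w = -1], pairing [g c] with [p] reads off the coefficient of [w]; if
    that is zero, [g c] is [c]. *)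
Let g_eq0 c : c \in C -> g c = 0 -> c = 0.
Proof.
move=> cC gc0; have := congr1 (b p) gc0.
rewrite /g bformDr bformNr bformZr (bformC p w) wp (bformC p c) Cp// bform0r => h.
have {}h : b c n1 / b n1 m = 0 by lra.
by move: gc0; rewrite /g h scale0r subr0.
Qed.

Let sigD1 : has_signature b D1 2 1.
Proof.
apply: has_signature21_hyperbolic; rewrite ?ww ?wn1 ?(bformC n) ?wn ?n1n//.
Qed.

Lemma surface_dupin_cyclide : exists D1 D2,
  dupin_cyclide b D1 D2 /\ curvature_line_parametrization b p D1 D2 I J
    (fun u t => sig t (gam u)).
Proof.
have [x [y [z [CE [[xx yy zz] [xy xz yz]]]]]] := has_signature21E sigC.
have [xC yC zC] : [/\ x \in C, y \in C & z \in C].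
  by rewrite CE; split; apply: memv_span; rewrite !inE eqxx ?orbT.
pose D2 := <<[:: g x; g y; g z]>>%VS.
have g3 r s t : g (r *: x + s *: y + t *: z) = r *: g x + s *: g y + t *: g z.
  by rewrite -[X in g (X + _)]scale1r !g_linear scale1r.
have gD2 c : c \in C -> g c \in D2.
  by rewrite CE => /span3P[r [s [t ->]]]; apply/span3P; exists r, s, t.
have D2P v : v \in D2 -> exists2 c, c \in C & v = g c.
  move=> /span3P[r [s [t ->]]]; exists (r *: x + s *: y + t *: z) => //.
  by rewrite !memvD// memvZ.
have sigD2 : has_signature b D2 2 1.
  apply: (@has_signature21I _ _ _ (g x) (g y) (g z)); rewrite ?gD2//.
    by split; split; rewrite g_isometry.
  exact: dim_span.
have D12 v v' : v \in D1 -> v' \in D2 -> b v v' = 0.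
  by move=> vD /D2P[c cC ->]; rewrite bformC g_orthogonal.
exists D1, D2; split.
  split=> //; apply/eqP; rewrite eqEdim subvf/= dimv_disjoint_sum.
    by rewrite (has_signature21_dim sigD1) (has_signature21_dim sigD2) dimvf dim_matrix.
  (* A common vector is orthogonal to the nondegenerate [D1] that contains it, hence zero; the
     dimensions then add up to 6. *)
  apply/eqP; rewrite -subv0; apply/subvP => v; rewrite memv_cap memv0 => /andP[v1 v2].
  apply/eqP/(has_signature21_nondegenerate sigD1 v1) => v' v'D.
  by rewrite bformC D12.
exists (fun t => sig t w), (fun u => g (gam u)); split.
- split=> t Jt.
    have [d d0 dv] := sig_derive Jt; have sd := dv _ wn; split; first by case: sd.
    rewrite (derive1_is_derive sd); apply/free2P => r s.
    rewrite -!lie_inversionZ ?aa// -lie_inversionD ?aa// => /(lie_inversion_eq0 (aa Jt)) E.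
    (* Pairing with [p] leaves only the coefficient of [w]; pairing with [n] then leaves that of the
       velocity. *)
    have := congr1 (b p) E; rewrite bformDr !bformZr (bformC p w) wp (bformC p n) np.
    rewrite bform0r => r0; have {}r0 : r = 0 by lra.
    split=> //; have := congr1 (b n) E.
    rewrite r0 scale0r add0r !bformZr bform0r wn1 => /eqP.
    by rewrite !mulf_eq0 (negbTE d0) (negbTE k0) (gt_eqF nn) !orbF => /eqP.
  split; first exact: sig_mem.
  split; last by rewrite lie_inversion_isometry ?aa.
  apply/eqP => /(lie_inversion_eq0 (aa Jt)) w0; have := wp; rewrite w0 bform0l => /eqP.
  by rewrite eq_sym oppr_eq0 oner_eq0.
- split=> u Iu; last first.
    split; first by rewrite gD2// gamC.
    split; last by rewrite g_isometry ?gamC// gamgam.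
    by apply: contra_neq (gam0 Iu); apply: g_eq0; exact: gamC.
  have [gd dC _ fg] := circle_parametrization_derive param Iu.
  have sd : is_derive u 1 (fun u => g (gam u)) (g (derive1 gam u)).
    have H := is_deriveB gd (is_derive_scale
      (is_deriveM (is_derive_form b gd (is_derive_cst n1 u 1))
                  (is_derive_cst (b n1 m)^-1 u 1)) (is_derive_cst w u 1)).
    apply: (is_derive_eq H); rewrite /g bform0r scaler0 addr0 !scaler0 addr0 add0r.
    by rewrite /GRing.scale/= [_^-1 * _]mulrC.
  split; first by case: sd.
  rewrite (derive1_is_derive sd); apply/free2P => r s.
  rewrite -g_linear => /g_eq0 E; apply: (free2P _ _ fg); apply: E.
  by rewrite memvD// memvZ// gamC.
- move=> u t Iu Jt; split; first exact: point.
  apply/span2P; exists (b (gam u) n1 / b n1 m), 1.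
  have gE : gam u = (b (gam u) n1 / b n1 m) *: w + 1 *: g (gam u).
    by rewrite scale1r addrC subrK.
  have nD : n \in D1 by apply: memv_span; rewrite !inE eqxx !orbT.
  have n1D : n1 \in D1 by apply: memv_span; rewrite !inE eqxx !orbT.
  have gf : sig t (g (gam u)) = g (gam u).
    by apply: fixed; rewrite // g_orthogonal// gamC.
  by rewrite [X in sig t X = _]gE (lie_inversionD (aa Jt) (_ *: _)) !lie_inversionZ ?aa// gf.
Qed.

End Cyclide.

(** * The case of orthogonal coordinates on a fixed sphere *)

Section Sphere.
Hypothesis k0 : b n1 m = 0.

Let n1C : n1 \in C.
Proof. exact: CP. Qed.

(** If [n1] were zero, [a t] and its derivative would both be multiples of [n], against their
    independence. *)
Let n10 t : J t -> n1 != 0.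
Proof.
move=> /areg[_ /span2P[r [s aE]] [da [_ /span2P[r' [s' daE]] fa]]].
apply/eqP => n0; have [|r'0 r0] := free2P _ _ fa r' (- r).
  by rewrite aE daE n0; apply/rowP => j; rewrite !mxE; ring.
have {}r0 : r = 0 by lra.
have [|+ _] := free2P _ _ fa 1 0; last by move/eqP; rewrite oner_eq0.
by rewrite aE n0 r0 !scaler0 !scale0r !addr0 scaler0.
Qed.

(** Together with [sigp] this fixes the sphere [m + p], so contact with it persists. *)
Let sigm t : J t -> sig t m = m.
Proof. by move=> Jt; apply: fixed; rewrite // bformC. Qed.

Let partial_uE u t : I u -> J t ->
  is_derive u 1 (fun u => sig t (gam u)) (sig t (derive1 gam u)).
Proof.
move=> Iu Jt; have [gd _ _ _] := circle_parametrization_derive param Iu.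
have gd2 : is_derive u 1 (fun u => 2 * b (gam u) (a t))
    (2 * b (derive1 gam u) (a t)).
  have H := is_derive_form b gd (is_derive_cst (a t) u 1).
  by have H' := is_deriveZ 2 H; apply: (is_derive_eq H'); rewrite bform0r addr0.
have H := is_deriveB gd (is_derive_scale
  (is_derive_div (aa Jt) gd2 (is_derive_cst (b (a t) (a t)) u 1))
  (is_derive_cst (a t) u 1)).
apply: (is_derive_eq H); rewrite /lie_inversion scaler0 addr0 mulr0 subr0.
by congr (_ - _ *: _); field; exact: aa.
Qed.

Lemma surface_orthogonal_coordinates :
  orthogonal_circular_coordinates b p I J (fun u t => sig t (gam u)).
Proof.
exists (m + p); split.
  split; last by rewrite !bformE mm pp (bformC p m) mp; ring.
  apply/eqP => mp0; have := congr1 (b p) mp0.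
  rewrite bformDr (bformC p m) mp pp bform0r add0r => /eqP.
  by rewrite oppr_eq0 oner_eq0.
split.
- move=> u t Iu Jt; split; first exact: point.
  rewrite /oriented_contact lie_inversion_self_adjoint ?aa//.
  by rewrite lie_inversionD ?aa// sigm// sigp// bformDr Cm ?gamC// Cp ?gamC// addr0.
- move=> t Jt.
  have [x [y [z [CE [[xx yy zz] [xy xz yz]]]]]] := has_signature21E sigC.
  have [xC yC zC] : [/\ x \in C, y \in C & z \in C].
    by rewrite CE; split; apply: memv_span; rewrite !inE eqxx ?orbT.
  pose C' := <<[:: sig t x; sig t y; sig t z]>>%VS.
  have CC' v : v \in C' -> exists2 c, c \in C & v = sig t c.
    move=> /span3P[r [s [w ->]]]; exists (r *: x + s *: y + w *: z).
      by rewrite !memvD// memvZ.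
    by rewrite !lie_inversionD ?aa// !lie_inversionZ ?aa.
  have C'C c : c \in C -> sig t c \in C'.
    rewrite CE => /span3P[r [s [w ->]]]; apply/span3P; exists r, s, w.
    by rewrite !lie_inversionD ?aa// !lie_inversionZ ?aa.
  exists C'; split; first split.
  + move=> v /CC'[c cC ->].
    by rewrite lie_inversion_self_adjoint ?aa// sigp// Cp.
  + apply: (@has_signature21I _ _ _ (sig t x) (sig t y) (sig t z)); rewrite ?C'C//.
      by split; split; rewrite lie_inversion_isometry ?aa.
    exact: dim_span.
  + move=> v /CC'[c cC ->]; rewrite lie_inversion_self_adjoint ?aa//.
    by rewrite lie_inversionD ?aa// sigm// sigp// bformDr Cm// Cp// addr0.
  + by move=> u Iu; rewrite C'C// gamC.
- move=> u Iu; have guC := gamC Iu.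
  (* If [gam u] is not orthogonal to [n1], its orbit stays in the span of [gam u], [n1] and [n].
     Otherwise [gam u] is fixed, and any [w] in [C] not orthogonal to it gives a circle through
     it. *)
  have [w [wC gw wx]] : exists w, [/\ w \in C, b (gam u) w != 0 &
      forall t, J t -> sig t (gam u) \in <<[:: gam u; w; n]>>%VS].
    have [gn1|gn1] := eqVneq (b (gam u) n1) 0; last first.
      by exists n1; split=> // t Jt; exact: sig_mem.
    have [w [wC gw]] : exists w, w \in C /\ b (gam u) w != 0.
      apply: contrapT => noex; move/eqP: (gam0 Iu); apply.
      apply: (has_signature21_nondegenerate sigC guC) => w wC.
      by apply/eqP; apply: contrapT => /negP gw; apply: noex; exists w.
    exists w; split=> // t Jt; rewrite fixed ?Cn//.
    by apply: memv_span; rewrite inE eqxx.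
  exists <<[:: gam u; w; n]>>%VS; split=> //; first split.
  + move=> v /span3P[r [s [l ->]]].
    by rewrite !bformE (Cp guC) (Cp wC) np; ring.
  + by apply: has_signature21_hyperbolic; rewrite ?gamgam// bformC Cn.
  + move=> v /span3P[r [s [l ->]]].
    by rewrite !bformE (Cp guC) (Cp wC) np (Cm guC) (Cm wC) nm; ring.
- move=> u t Iu Jt; have ud := partial_uE Iu Jt.
  have [d d0 dv] := sig_derive Jt; have td := dv _ (Cn (gamC Iu)).
  split; [by case: ud|by case: td|].
  rewrite /partial_u /partial_t (derive1_is_derive ud) (derive1_is_derive td).
  have [_ dC _ _] := circle_parametrization_derive param Iu.
  by rewrite lie_inversion_isometry ?aa// bformZr Cn// mulr0.
move=> [u t] [/= Iu Jt] B [[P Q] /= [nP nQ] PQ].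
(* The [t]-velocity degenerates only where [gam] is orthogonal to [n1]. As [n1] is a nonzero vector
   of [C], moving [u] slightly avoids this, while [t] is kept. *)
have [s [Ps Is gs]] := circle_parametrization_dense sigC param n1C (n10 Jt) Iu nP.
exists (s, t); split; last by apply: PQ; split=> //; exact: nbhs_singleton.
split=> //=; have sd := partial_uE Is Jt.
have [d d0 dv] := sig_derive Jt; have td := dv _ (Cn (gamC Is)).
rewrite /partial_u /partial_t (derive1_is_derive sd) (derive1_is_derive td).
have [_ dC _ fg] := circle_parametrization_derive param Is.
apply/free3P => r1 r2 r3.
rewrite -!lie_inversionZ ?aa// -!lie_inversionD ?aa// => /(lie_inversion_eq0 (aa Jt)) E.
(* [n] is orthogonal to [C], so pairing with it isolates the [t]-velocity; what remains is a
   relation between [gam s] and its derivative. *)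
have r30 : r3 = 0.
  have := congr1 (b n) E; rewrite !bformE (bformC n (gam s)) Cn ?gamC//.
  rewrite (bformC n (derive1 _ _)) Cn// !mulr0 !add0r => /eqP.
  by rewrite !mulf_eq0 (negbTE d0) (negbTE gs) (gt_eqF nn) !orbF => /eqP.
have [|r10 r20] := free2P _ _ fg r1 r2; last by split.
by move: E; rewrite r30 scale0r addr0.
Qed.

End Sphere.
End Surface.

(** Subtracting from [v] its components along [x], [y], [z] leaves a vector orthogonal to all six
    members of an orthogonal basis. The sign at [z] comes from [b z z = -1]. *)
Lemma mem_frame21 (R : realType) (b : {symmetric 'rV[R]_6}) (x y z n m p v : 'rV[R]_6) :
  frame21 b x y z -> b n n != 0 -> b m m != 0 -> b p p != 0 ->
  [/\ b n m = 0, b n p = 0 & b m p = 0] ->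
  (forall c, c \in <<[:: x; y; z]>>%VS -> [/\ b c n = 0, b c m = 0 & b c p = 0]) ->
  [/\ b v n = 0, b v m = 0 & b v p = 0] -> v \in <<[:: x; y; z]>>%VS.
Proof.
move=> [[xx yy zz] [xy xz yz]] nn mm pp [nm np mp] Cnmp [vn vm vp].
have mem i : (i < 3)%N -> [:: x; y; z]`_i \in <<[:: x; y; z]>>%VS.
  by move=> i3; apply/memv_span/mem_nth.
have [xn xm xp] := Cnmp _ (mem 0 isT).
have [yn ym yp] := Cnmp _ (mem 1 isT).
have [zn zm zp] := Cnmp _ (mem 2 isT).
pose e (i : 'I_6) := [:: x; y; z; n; m; p]`_i.
suff : v - (b v x *: x + b v y *: y + - b v z *: z) = 0.
  by move/subr0_eq => vE; apply/span3P; exists (b v x), (b v y), (- b v z).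
apply: (@orthogonal_family_eq0 _ b e).
- move=> [[|[|[|[|[|[|//]]]]]] i6]; rewrite /e//= ?xx ?yy ?zz ?oppr_eq0 ?oner_eq0//.
- move=> [[|[|[|[|[|[|//]]]]]] i6] [[|[|[|[|[|[|//]]]]]] j6] //= _; rewrite /e//=;
    by rewrite bformC.
- move=> [[|[|[|[|[|[|//]]]]]] i6]; rewrite /e/= !bformE ?(bformC z x, bformC z y, bformC y x)
    ?(xx, yy, zz, xy, xz, yz, xn, xm, xp, yn, ym, yp, zn, zm, zp, vn, vm, vp); ring.
Qed.

Theorem corollary7 (R : realType) (b : {symmetric 'rV[R]_6})
    (hb : has_signature b fullv 4 2)
    (p : 'rV[R]_6) (hp : b p p = -1)
    (s1 s2 : 'rV[R]_6) (hs1 : sphere b s1) (hs2 : sphere b s2)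
    (hs12 : s1 \notin <<[:: s2; p]>>%VS)
    (J : set R) (q : R -> 'rV[R]_6)
    (hq : pencil_parametrization b (msphere_pencil p s1 s2) J q)
    (t0 : R) (ht0 : J t0) (hq0 : ~ point_sphere b p (q t0))
    (C : {vspace 'rV[R]_6}) (hC : circle b p C) (hCq0 : circle_on b C (q t0))
    (I : set R) (gam : R -> 'rV[R]_6)
    (hgam : circle_parametrization b C I gam) :
  let Jstar := evolution_domain b p J q t0 in
  let x := fun u t : R => evolution_map b p q t0 t (gam u) in
  orthogonal_circular_coordinates b p I Jstar x \/
  exists D1 D2 : {vspace 'rV[R]_6},
    dupin_cyclide b D1 D2 /\
    curvature_line_parametrization b p D1 D2 I Jstar x.
Proof.
move=> Jstar x; have [_ _ /(_ _ ht0)[q0M [q0_neq0 q00]]] := hq.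
have k0 : b (q t0) p != 0.
  by apply/eqP => q0p; apply: hq0; split.
(* The square of this projection is [b (q t0) p ^+ 2], positive because the initial sphere is not a
   point sphere. *)
pose n := q t0 + b (q t0) p *: p.
have np : b n p = 0 by rewrite !bformE hp; ring.
have nn : 0 < b n n.
  suff -> : b n n = b (q t0) p ^+ 2 by rewrite exprn_even_gt0.
  by rewrite !bformE (bformC p (q t0)) hp q00; ring.
have nM : n \in msphere_pencil p s1 s2.
  by rewrite memvD// memvZ// memv_span// !inE eqxx !orbT.
have [n1 [n1p n1n MN]] := pencil_point_complex hp nM np (lt0r_neq0 nn).
have [Cp sigC] := hC.
have Cn v : v \in C -> b v n = 0.
  by move=> vC; rewrite bformDr bformZr hCq0// (Cp v)// mulr0 addr0.
have [e1 [e2 [e3 [CE fr]]]] := has_signature21E sigC.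
have [e1C e2C e3C] : [/\ e1 \in C, e2 \in C & e3 \in C].
  by rewrite CE; split; apply: memv_span; rewrite !inE eqxx ?orbT.
(* Of signature (4, 2), [C] uses (2, 1), [n] a positive and [p] a negative square, which leaves one
   positive direction [m]. *)
have [|m [mm [e1m e2m e3m nm mp]]] := orthogonal_complement hb fr nn hp _
    (And3 (Cp _ e1C) (Cp _ e2C) (Cp _ e3C)).
  by rewrite !Cn.
have Cm v : v \in C -> b v m = 0.
  by rewrite CE => /span3P[r [s [t ->]]]; rewrite !bformE e1m e2m e3m; ring.
have CP v : b v p = 0 -> b v n = 0 -> b v m = 0 -> v \in C.
  move=> vp vn vm; rewrite CE; apply: (mem_frame21 (n := n) (m := m) (p := p) fr);
    rewrite ?mm ?hp ?oppr_eq0 ?oner_eq0 ?lt0r_neq0// -CE => c cC.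
  by rewrite Cn// Cm// Cp.
have areg t : Jstar t -> [/\ b (evolution_vector b p q t0 t)
      (evolution_vector b p q t0 t) != 0,
    evolution_vector b p q t0 t \in <<[:: n; n1]>>%VS &
    exists da, [/\ is_derive t 1 (evolution_vector b p q t0) da,
      da \in <<[:: n; n1]>>%VS & free [:: evolution_vector b p q t0 t; da]]].
  move=> Jt; have [aa ap aM [da [ad dap daM fa]]] :=
    evolution_vector_regular hq ht0 k0 Jt.
  by split=> //; [exact: MN|exists da; split=> //; exact: MN].
(* By [CP] and [Cm] this decides whether [n1] lies in [C]. *)
have [n1m|n1m] := eqVneq (b n1 m) 0.
- by left; exact: (surface_orthogonal_coordinates hp mm nn np mp nm sigC
    Cp Cn Cm CP n1p n1n hgam areg n1m).
- by right; exact: (surface_dupin_cyclide hp mm nn np mp nm sigC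
    Cp Cn Cm n1p n1n hgam areg n1m).
Qed.
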